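(* Let $N_1\le N_2$ be positive integers, let $w$ be a uniformly bounded function supported in $[N_1,N_2]$, and let $b$ be an arithmetic function with $|b(n)|\ll_{\varepsilon} n^{\varepsilon}$ for every $\varepsilon>0$. Put $$P(t)=\sum_{N_1\le n\le N_2}\frac{w(n)b(n)}{n^{1/2+it}} .$$ Then, as $T\to\infty$, for every $\varepsilon>0$, $$\int_{-T}^{T}|P(t)|^2\,dt\ \ll_{\varepsilon}\ T^2\int_{N_1/2}^{3N_2/2}\Big|\sum_{y-y/T\le n\le y+y/T}\Big(1-\frac{|n-y|}{y/T}\Big)\frac{w(n)b(n)}{n^{1/2}}\Big|^2\frac{dy}{y}\ +\ \frac{N_2^{1+\varepsilon}}{T^2}.$$ Here the bound holds for all $T\ge T_0$ with $T_0>1$ a sufficiently large absolute constant, and the implied constant depends only on $\varepsilon$, on the bound for $|w|$, and on the constants in the hypothesis $|b(n)|\ll_\varepsilon n^\varepsilon$ (it does not depend on $T$, $N_1$, $N_2$).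
   Context: An arithmetic function is a function $b:\{1,2,3,\dots\}\to\mathbb{C}$. The notation $A\ll_\varepsilon B$ means $|A|\le C B$ for some constant $C>0$ that may depend on $\varepsilon$; thus $|b(n)|\ll_\varepsilon n^\varepsilon$ for every $\varepsilon>0$ means that for each $\varepsilon>0$ there is a constant $B_\varepsilon>0$ with $|b(n)|\le B_\varepsilon n^\varepsilon$ for all $n\ge1$. ''Uniformly bounded'' means there is a constant $M$, independent of $N_1,N_2,T$, with $|w(n)|\le M$ for all $n$; ''supported in $[N_1,N_2]$'' means $w(n)=0$ for $n\notin[N_1,N_2]$. Inner sums are over positive integers $n$. *)

(* Defs.v *)
From Stdlib Require Export Reals.
From Coquelicot Require Export Coquelicot.
Open Scope R_scope.

Definition Cexp (z : C) : C :=
  (exp (Re z) * cos (Im z), exp (Re z) * sin (Im z)).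

(* n^s = exp (s log n) with the real logarithm, for n >= 1. *)
Definition npow (n : nat) (s : C) : C :=
  Cexp (Cmult s (RtoC (ln (INR n)))).

(* An arithmetic function is represented by a function on [nat]; only its values
   at n >= 1 are ever used. *)
Definition dirichletPoly (N1 N2 : nat) (w b : nat -> C) (t : R) : C :=
  sum_n_m (fun n => Cdiv (Cmult (w n) (b n)) (npow n (1 / 2, t))) N1 N2.

(* Sum of f n over the positive integers n with x1 <= n <= x2, for real x1, x2.
   Since x2 < up x2, the range 1 .. up x2 contains every such n. *)
Definition sumBetween (x1 x2 : R) (f : nat -> C) : C :=
  sum_n_m
    (fun n => if Rle_dec x1 (INR n)
              then (if Rle_dec (INR n) x2 then f n else RtoC 0)
              else RtoC 0)
    1 (Z.to_nat (up x2)).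

Definition shortSum (w b : nat -> C) (T y : R) : C :=
  sumBetween (y - y / T) (y + y / T)
    (fun n => Cmult (RtoC (1 - Rabs (INR n - y) / (y / T)))
                    (Cdiv (Cmult (w n) (b n)) (RtoC (sqrt (INR n))))).

(* Main.v *)
Require Import Defs.
From Stdlib Require Import Reals Lra Lia FunctionalExtensionality.
From Coquelicot Require Import Coquelicot.

(** In the variable [u = ln y] the short sum is [G u = sum_n c_n k (ln n - u)] with
    [k v = max (0, 1 - T |e^v - 1|)], so its Fourier transform at [t] is [kappa t * P t],
    where [kappa t] is the integral of [k v e^(itv)].  Since [k] lives on
    [|v| <= 1 / (T - 1)], [|kappa t| >= 1 / (16 T)] for [|t| <= T].  It remains to bound
    the square integral of the Fourier transform over [[-T, T]] by [2 pi] times that of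
    [G]: on an interval of length [2 pi / h] the exponentials at frequencies [s + j h]
    are orthogonal, so Bessel's inequality bounds the sum over the lattice, and
    integrating over [s] in an interval of length [h] gives the claim. *)

(** * Finite sums of functions *)

(** One induction that serves every additive property of a sum of functions: continuity, and the
    formulas for integrals of such a sum. *)
Lemma sum_n_m_fct_rel {U : Type} {G H : AbelianMonoid} (Q : (U -> G) -> H -> Prop)
  (f : nat -> U -> G) (g : nat -> H) (n m : nat) :
  Q (fun _ => zero) zero ->
  (forall F F' y y', Q F y -> Q F' y' -> Q (fun u => plus (F u) (F' u)) (plus y y')) ->
  (forall i, (n <= i <= m)%nat -> Q (f i) (g i)) ->
  Q (fun u => sum_n_m (fun i => f i u) n m) (sum_n_m g n m).
Proof.
intros Q0 Qp.
assert (Qz : forall k, (k < n)%nat -> Q (fun u => sum_n_m (fun i => f i u) n k) (sum_n_m g n k)).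
{ intros k Hk; rewrite sum_n_m_zero by exact Hk.
  (* [Q] is an arbitrary relation and need not respect pointwise equality, so the summed function is
     rewritten as an equal function by extensionality. *)
  replace (fun u => _) with (fun _ : U => @zero G); [exact Q0|].
  apply functional_extensionality; intro u; now rewrite sum_n_m_zero. }
assert (QS : forall k, (n <= S k)%nat ->
  Q (fun u => sum_n_m (fun i => f i u) n k) (sum_n_m g n k) -> Q (f (S k)) (g (S k)) ->
  Q (fun u => sum_n_m (fun i => f i u) n (S k)) (sum_n_m g n (S k))).
{ intros k Hk H1 H2; rewrite sum_n_Sm by exact Hk.
  replace (fun u => _) with (fun u => plus (sum_n_m (fun i => f i u) n k) (f (S k) u));
    [now apply Qp|].
  apply functional_extensionality; intro u; now rewrite sum_n_Sm. }
induction m as [|m IH]; intros Hi.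
- destruct n as [|n]; [|apply Qz; lia].
  rewrite sum_n_n.
  replace (fun u => _) with (f 0%nat); [apply Hi; lia|].
  apply functional_extensionality; intro u; now rewrite sum_n_n.
- destruct (Nat.le_gt_cases n (S m)) as [Hn|Hn]; [|apply Qz; lia].
  apply QS; [exact Hn | apply IH; intros; apply Hi; lia | apply Hi; lia].
Qed.

Lemma sum_n_m_rel {G H : AbelianMonoid} (Q : G -> H -> Prop)
  (f : nat -> G) (g : nat -> H) (n m : nat) :
  Q zero zero ->
  (forall x y x' y', Q x y -> Q x' y' -> Q (plus x x') (plus y y')) ->
  (forall i, (n <= i <= m)%nat -> Q (f i) (g i)) ->
  Q (sum_n_m f n m) (sum_n_m g n m).
Proof.
intros Q0 Qp Hi.
apply (sum_n_m_fct_rel (fun (F : unit -> G) z => Q (F tt) z) (fun i _ => f i) g); auto.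
Qed.

(** * Continuity and Riemann integrals of real functions *)

Lemma continuous_Rplus (f g : R -> R) (x : R) :
  continuous f x -> continuous g x -> continuous (fun u => f u + g u) x.
Proof. exact (continuous_plus f g x). Qed.

Lemma continuous_Rminus (f g : R -> R) (x : R) :
  continuous f x -> continuous g x -> continuous (fun u => f u - g u) x.
Proof. exact (continuous_minus f g x). Qed.

Lemma continuous_Ropp (f : R -> R) (x : R) :
  continuous f x -> continuous (fun u => - f u) x.
Proof. exact (continuous_opp f x). Qed.

Lemma continuous_Rmult (f g : R -> R) (x : R) :
  continuous f x -> continuous g x -> continuous (fun u => f u * g u) x.
Proof. exact (continuous_mult f g x). Qed.

Lemma continuous_Rmax (f g : R -> R) (x : R) :
  continuous f x -> continuous g x -> continuous (fun u => Rmax (f u) (g u)) x.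
Proof.
intros Hf Hg.
apply (continuous_ext (fun u => (f u + g u + Rabs (f u - g u)) * / 2)).
- intro u; unfold Rmax, Rabs; destruct (Rle_dec (f u) (g u)), (Rcase_abs (f u - g u)); lra.
- apply continuous_Rmult; [|apply continuous_const].
  apply continuous_Rplus; [now apply continuous_Rplus|].
  now apply continuous_Rabs_comp, continuous_Rminus.
Qed.

Lemma continuous_sin_comp (f : R -> R) (x : R) :
  continuous f x -> continuous (fun u => sin (f u)) x.
Proof.
intro Hf; apply (continuous_comp f sin); [exact Hf | apply continuous_sin].
Qed.

(* The shape is matched syntactically because [apply] would try to unify the real
   operations by unfolding them; the [Rplus c], ... cases are eta-contracted forms
   left by [simpl]. *)
Ltac cont :=
  first [ assumption
        | match goal with H : forall u, continuous _ u |- _ => exact (H _) end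
        | lazymatch goal with
          | |- continuous (fun x => x) _ => apply continuous_id
          | |- continuous (fun x => _ + _) _ => apply continuous_Rplus; cont
          | |- continuous (fun x => _ - _) _ => apply continuous_Rminus; cont
          | |- continuous (fun x => - _) _ => apply continuous_Ropp; cont
          | |- continuous (fun x => _ * _) _ => apply continuous_Rmult; cont
          | |- continuous (Rplus ?c) _ => apply (continuous_Rplus (fun _ => c) (fun x => x)); cont
          | |- continuous (Rminus ?c) _ => apply (continuous_Rminus (fun _ => c) (fun x => x)); cont
          | |- continuous (Rmult ?c) _ => apply (continuous_Rmult (fun _ => c) (fun x => x)); cont
          | |- continuous (fun x => Rmax _ _) _ => apply continuous_Rmax; cont
          | |- continuous (fun x => Rabs _) _ => apply continuous_Rabs_comp; cont
          | |- continuous (fun x => cos _) _ => apply continuous_cos_comp; cont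
          | |- continuous (fun x => sin _) _ => apply continuous_sin_comp; cont
          | |- continuous (fun x => exp _) _ => apply continuous_exp_comp; cont
          | |- continuous exp _ => apply continuous_exp
          | |- continuous (fun x => _) _ => apply continuous_const
          end ].

Lemma RInt_eq (f g : R -> R) (a b : R) :
  (forall u, f u = g u) -> RInt f a b = RInt g a b.
Proof. intro H; apply RInt_ext; intros u _; apply H. Qed.

Lemma ex_RInt_cont (f : R -> R) (a b : R) :
  (forall u, continuous f u) -> ex_RInt f a b.
Proof. intro H; apply (ex_RInt_continuous (V := R_CompleteNormedModule)); intros; apply H. Qed.

(** Three terms suffice for all the linear identities that follow; shorter combinations are padded
    with the zero function. *)
Lemma RInt_comb (f g h : R -> R) (x y z a b : R) :
  (forall u, continuous f u) -> (forall u, continuous g u) -> (forall u, continuous h u) ->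
  RInt (fun u => x * f u + (y * g u + z * h u)) a b
  = x * RInt f a b + (y * RInt g a b + z * RInt h a b).
Proof.
intros Hf Hg Hh; apply is_RInt_unique.
apply (is_RInt_plus (V := R_NormedModule) (fun u => x * f u) (fun u => y * g u + z * h u)).
- apply (is_RInt_scal (V := R_NormedModule) f), (RInt_correct (V := R_CompleteNormedModule)).
  now apply ex_RInt_cont.
- apply (is_RInt_plus (V := R_NormedModule) (fun u => y * g u) (fun u => z * h u)).
  + apply (is_RInt_scal (V := R_NormedModule) g), (RInt_correct (V := R_CompleteNormedModule)).
    now apply ex_RInt_cont.
  + apply (is_RInt_scal (V := R_NormedModule) h), (RInt_correct (V := R_CompleteNormedModule)).
    now apply ex_RInt_cont.
Qed.

Lemma RInt_split (f : R -> R) (a b c : R) :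
  (forall u, continuous f u) -> RInt f a c = RInt f a b + RInt f b c.
Proof.
intro Hf; symmetry.
apply (RInt_Chasles (V := R_CompleteNormedModule)); apply ex_RInt_cont; assumption.
Qed.

Lemma RInt_nonneg (f : R -> R) (a b : R) :
  a <= b -> (forall u, continuous f u) -> (forall u, a < u < b -> 0 <= f u) ->
  0 <= RInt f a b.
Proof.
intros Hab Hf H; apply Rle_trans with (RInt (fun _ => 0) a b).
- rewrite RInt_const; unfold scal; simpl; unfold mult; simpl; lra.
- apply RInt_le; try assumption; apply ex_RInt_cont; intro; cont.
Qed.

Lemma RInt_zero (f : R -> R) (a b : R) :
  (forall u, Rmin a b < u < Rmax a b -> f u = 0) -> RInt f a b = 0.
Proof.
intro H; rewrite (RInt_ext f (fun _ => 0)) by exact H.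
rewrite RInt_const; unfold scal; simpl; unfold mult; simpl; lra.
Qed.

(** The substitution [u = L - v] centres the support at 0. For a kernel evaluated at [L - u] this
    removes [a], [b] and [L] from the limits, so that its transform factors out of each term of the
    smoothed sum. *)
Lemma RInt_reflect_support (f : R -> R) (a b L d : R) :
  (forall u, continuous f u) -> 0 <= d -> a <= L - d -> L + d <= b ->
  (forall u, d <= Rabs (L - u) -> f u = 0) ->
  RInt f a b = RInt (fun v => f (L - v)) (- d) d.
Proof.
intros Hf Hd Ha Hb H0.
rewrite (RInt_split f a (L - d) b Hf), (RInt_split f (L - d) (L + d) b Hf).
rewrite (RInt_zero f a (L - d)), (RInt_zero f (L + d) b).
(* The slope [-1] reverses the limits to [d], [- d] and contributes a factor [-1]; swapping the
   limits cancels it. *)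
- pose proof (RInt_comp_lin (V := R_CompleteNormedModule) f (-1) L d (- d)) as E.
  replace (-1 * d + L) with (L - d) in E by ring.
  replace (-1 * - d + L) with (L + d) in E by ring.
  rewrite <- E by (apply ex_RInt_cont; exact Hf).
  rewrite Rplus_0_l, Rplus_0_r.
  rewrite (RInt_ext _ (fun v => -1 * f (L - v))).
  + transitivity (-1 * RInt (fun v => f (L - v)) d (- d)).
    * apply (RInt_scal (V := R_CompleteNormedModule) (fun v => f (L - v)) d (- d) (-1)).
      apply ex_RInt_cont; intro u; apply (continuous_comp (fun v => L - v) f); cont.
    * rewrite <- (opp_RInt_swap (V := R_CompleteNormedModule) (fun v => f (L - v)) (- d) d).
      -- unfold scal, opp; simpl; unfold mult; simpl; ring.
      -- apply ex_RInt_cont; intro u; apply (continuous_comp (fun v => L - v) f); cont.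
  + intros v _; unfold scal; simpl; unfold mult; simpl.
    replace (-1 * v + L) with (L - v) by ring; reflexivity.
- intros u Hu; apply H0; rewrite Rmin_left, Rmax_right in Hu by lra.
  rewrite Rabs_left; lra.
- intros u Hu; apply H0; rewrite Rmin_left, Rmax_right in Hu by lra.
  rewrite Rabs_right; lra.
Qed.

(** * Hermitian products in real form, and Bessel's inequality *)

Definition ccont (f : R -> C) : Prop :=
  (forall u, continuous (fun x => Re (f x)) u) /\ (forall u, continuous (fun x => Im (f x)) u).

(* The real and imaginary parts of the Hermitian product of [f] and [g] are
   [ip a b f g] and [ip a b f (rot g)]. *)
Definition ip (a b : R) (f g : R -> C) : R :=
  RInt (fun u => Re (f u) * Re (g u) + Im (f u) * Im (g u)) a b.

(** Multiplication of the values by [i]. *)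
Definition rot (f : R -> C) (u : R) : C := (- Im (f u), Re (f u)).

Lemma ccont_rot (f : R -> C) : ccont f -> ccont (rot f).
Proof. intros [H1 H2]; split; simpl; intro u; cont. Qed.

Lemma ccont_sub_mult (g e : R -> C) (z : C) :
  ccont g -> ccont e -> ccont (fun u => Cminus (g u) (Cmult z (e u))).
Proof.
intros [G1 G2] [E1 E2]; split; simpl; intro u; fold (Re z) (Im z);
  apply continuous_Rplus; try apply G1; try apply G2; cont.
Qed.

(** Pointwise [z e = Re z * e + Im z * rot e], so a complex multiple becomes a real combination, on
    which [ip] is linear. *)
Lemma ip_sub_mult (a b : R) (g e f : R -> C) (z : C) :
  ccont g -> ccont e -> ccont f ->
  ip a b (fun u => Cminus (g u) (Cmult z (e u))) f
  = ip a b g f - (Re z * ip a b e f + Im z * ip a b (rot e) f).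
Proof.
intros [G1 G2] [E1 E2] [F1 F2]; unfold ip.
transitivity (1 * RInt (fun u => Re (g u) * Re (f u) + Im (g u) * Im (f u)) a b
  + ((- Re z) * RInt (fun u => Re (e u) * Re (f u) + Im (e u) * Im (f u)) a b
  + (- Im z) * RInt (fun u => Re (rot e u) * Re (f u) + Im (rot e u) * Im (f u)) a b)); [|lra].
rewrite <- RInt_comb.
- apply RInt_eq; intro u; unfold rot, Re, Im; simpl; ring.
- intro; cont.
- intro; cont.
- intro; unfold rot; simpl; cont.
Qed.

Lemma ip_sym (a b : R) (f g : R -> C) : ip a b f g = ip a b g f.
Proof. apply RInt_eq; intro; ring. Qed.

Lemma ip_rot_rot (a b : R) (f g : R -> C) : ip a b (rot f) (rot g) = ip a b f g.
Proof. apply RInt_eq; intro; unfold rot; simpl; ring. Qed.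

Lemma ip_rot_l (a b : R) (f g : R -> C) :
  ccont f -> ccont g -> ip a b (rot f) g = - ip a b f (rot g).
Proof.
intros [F1 F2] [G1 G2]; unfold ip.
rewrite <- (RInt_opp (V := R_CompleteNormedModule)).
- apply RInt_eq; intro; unfold rot, opp; simpl; ring.
- apply ex_RInt_cont; intro; unfold rot; simpl; cont.
Qed.

Lemma ip_pos (a b : R) (f : R -> C) : a <= b -> ccont f -> 0 <= ip a b f f.
Proof.
intros Hab [F1 F2]; apply RInt_nonneg; [exact Hab| |].
- intro; cont.
- intros; nra.
Qed.

(** Induction on [m] for all [g] at once: subtract from [g] its projection on the last vector and
    apply the induction hypothesis to the remainder [g']. The earlier coefficients do not change,
    and by Pythagoras [Lam * ip a b g' g'] drops by exactly the last term of the sum. *)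
Lemma bessel (a b Lam : R) (e : nat -> R -> C) (m : nat) :
  a <= b -> 0 < Lam ->
  (forall i, ccont (e i)) ->
  (forall i, ip a b (e i) (e i) = Lam) ->
  (forall i j, (i < j)%nat -> ip a b (e i) (e j) = 0 /\ ip a b (e i) (rot (e j)) = 0) ->
  forall g, ccont g ->
  sum_n_m (fun j => ip a b g (e j) ^ 2 + ip a b g (rot (e j)) ^ 2) 1 m <= Lam * ip a b g g.
Proof.
intros Hab HL He Hn Ho; induction m as [|m IH]; intros g Hg.
- rewrite sum_n_m_zero by lia; change (@zero R_AbelianMonoid) with 0.
  pose proof (ip_pos a b g Hab Hg); nra.
- rewrite sum_n_Sm by lia; unfold plus; simpl.
  set (x := ip a b g (e (S m))); set (y := ip a b g (rot (e (S m)))).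
  set (z := (x / Lam, y / Lam) : C).
  set (g' := fun u => Cminus (g u) (Cmult z (e (S m) u))).
  assert (Hg' : ccont g') by (apply ccont_sub_mult; auto).
  pose proof (He (S m)) as HeS; pose proof (ccont_rot _ HeS) as HrS.
  (* Skewness of [rot] and symmetry of [ip] make this quantity its own negative. *)
  assert (N0 : ip a b (e (S m)) (rot (e (S m))) = 0).
  { pose proof (ip_rot_l a b (e (S m)) (e (S m)) HeS HeS) as E.
    rewrite ip_sym in E; lra. }
  specialize (IH g' Hg').
  rewrite (sum_n_m_ext_loc (G := R_AbelianMonoid) _
            (fun j => ip a b g (e j) ^ 2 + ip a b g (rot (e j)) ^ 2)) in IH.
  + assert (E : Lam * ip a b g' g' = Lam * ip a b g g - (x ^ 2 + y ^ 2)).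
    { unfold g' at 1; rewrite ip_sub_mult by auto.
      rewrite (ip_sym a b g g'), (ip_sym a b (e (S m)) g'), (ip_sym a b (rot (e (S m))) g').
      unfold g'; rewrite !ip_sub_mult by auto.
      rewrite ip_rot_rot, (ip_sym a b (rot (e (S m))) (e (S m))), N0, Hn.
      rewrite (ip_sym a b (e (S m)) g), (ip_sym a b (rot (e (S m))) g).
      fold x y; unfold z; simpl; field; lra. }
    simpl in E, IH |- *; lra.
  (* Orthogonality to the last vector: [g] and [g'] have the same coefficients at [e k]. The
     reversed products come from symmetry and skewness. *)
  + intros k Hk; destruct (Ho k (S m) ltac:(lia)) as [O1 O2].
    assert (O3 : ip a b (rot (e k)) (e (S m)) = 0) by (rewrite ip_rot_l by auto; lra).
    assert (O4 : ip a b (e (S m)) (rot (e k)) = 0) by (rewrite ip_sym; exact O3).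
    unfold g'; rewrite !ip_sub_mult by auto using ccont_rot.
    rewrite ip_rot_rot, O4, (ip_sym a b (e (S m)) (e k)), O1, (ip_sym a b (rot (e (S m))) (e k)), O2.
    f_equal; f_equal; ring.
Qed.

(** * Exponentials on an interval and the mean square of a Fourier transform *)

(** [ip a b g (cis t)] and [ip a b g (rot (cis t))] are the real and imaginary parts of the integral
    of [g u * e^(-itu)]. *)
Definition cis (t u : R) : C := (cos (t * u), sin (t * u)).

Lemma ccont_cis (t : R) : ccont (cis t).
Proof. split; unfold cis; simpl; intro u; cont. Qed.

Lemma ip_cis_diag (a b t : R) : ip a b (cis t) (cis t) = b - a.
Proof.
unfold ip; rewrite (RInt_ext _ (fun _ => 1)).
- rewrite RInt_const; unfold scal; simpl; unfold mult; simpl; ring.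
- intros u _; simpl; rewrite Rplus_comm; apply sin2_cos2.
Qed.

Lemma RInt_cos_period (a b l : R) :
  l <> 0 -> sin (l * b) = sin (l * a) -> RInt (fun u => cos (l * u)) a b = 0.
Proof.
intros Hl H.
rewrite (is_RInt_unique (V := R_CompleteNormedModule) _ a b
  (minus (sin (l * b) / l) (sin (l * a) / l))).
- rewrite H; unfold minus, plus, opp; simpl; ring.
- apply (is_RInt_derive (V := R_CompleteNormedModule) (fun u => sin (l * u) / l)).
  + intros u _; auto_derive; [trivial | field; exact Hl].
  + intros u _; cont.
Qed.

Lemma RInt_sin_period (a b l : R) :
  l <> 0 -> cos (l * b) = cos (l * a) -> RInt (fun u => sin (l * u)) a b = 0.
Proof.
intros Hl H.
rewrite (is_RInt_unique (V := R_CompleteNormedModule) _ a b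
  (minus (- cos (l * b) / l) (- cos (l * a) / l))).
- rewrite H; unfold minus, plus, opp; simpl; ring.
- apply (is_RInt_derive (V := R_CompleteNormedModule) (fun u => - cos (l * u) / l)).
  + intros u _; auto_derive; [trivial | field; exact Hl].
  + intros u _; cont.
Qed.

(** The product of one exponential with the conjugate of the other has frequency [l = (j - i) h] up
    to sign, and [l (b - a)] is a multiple of [2 PI]: the integral runs over whole periods. *)
Lemma ip_cis_orth (a b h s : R) (i j : nat) :
  0 < h -> h * (b - a) = 2 * PI -> (i < j)%nat ->
  ip a b (cis (s + INR i * h)) (cis (s + INR j * h)) = 0 /\
  ip a b (cis (s + INR i * h)) (rot (cis (s + INR j * h))) = 0.
Proof.
intros Hh Hp Hij.
set (l := INR (j - i) * h).
assert (Hl : l <> 0).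
{ apply Rmult_integral_contrapositive; split; [apply not_0_INR; lia | lra]. }
assert (E : s + INR j * h = s + INR i * h + l)
  by (unfold l; rewrite minus_INR by lia; ring).
assert (Eb : l * b = l * a + 2 * INR (j - i) * PI).
{ replace (2 * INR (j - i) * PI) with (INR (j - i) * (2 * PI)) by ring.
  rewrite <- Hp; unfold l; ring. }
rewrite E; set (r := s + INR i * h); split; unfold ip, rot, cis; simpl.
- rewrite <- (RInt_cos_period a b l Hl) by (rewrite Eb; apply sin_period).
  apply RInt_eq; intro u.
  replace (l * u) with ((r + l) * u - r * u) by ring; rewrite cos_minus; ring.
- rewrite <- Ropp_0, <- (RInt_sin_period a b l Hl) by (rewrite Eb; apply cos_period).
  rewrite <- (RInt_opp (V := R_CompleteNormedModule)) by (apply ex_RInt_cont; intro; cont).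
  apply RInt_eq; intro u; unfold opp; simpl.
  replace (l * u) with ((r + l) * u - r * u) by ring; rewrite sin_minus; ring.
Qed.

Lemma continuous_sum_n_m (f : nat -> R -> R) (n m : nat) :
  (forall i u, continuous (f i) u) ->
  forall u, continuous (fun v => sum_n_m (fun i => f i v) n m) u.
Proof.
intros Hf u.
apply (sum_n_m_fct_rel (G := R_AbelianMonoid) (H := R_AbelianMonoid)
  (fun F _ => continuous F u) f (fun _ => 0)).
- apply continuous_const.
- intros F F' _ _; apply continuous_Rplus.
- intros; apply Hf.
Qed.

(** The interval is cut into [m] cells of length [h], each translated back to [[c - h, c]]. This
    base cell lies just left of [c], so the shifts are numbered from 1 to [m]. *)
Lemma RInt_fold_lattice (p : R -> R) (c h : R) (m : nat) :
  (forall u, continuous p u) ->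
  RInt p c (c + INR m * h)
  = RInt (fun s => sum_n_m (fun j => p (s + INR j * h)) 1 m) (c - h) c.
Proof.
intros Hp.
assert (Hs : forall j u, continuous (fun s => p (s + INR j * h)) u).
{ intros j u; apply (continuous_comp (fun s => s + INR j * h) p); cont. }
induction m as [|m IH].
- simpl INR; rewrite Rmult_0_l, Rplus_0_r, RInt_point.
  symmetry; apply RInt_zero; intros u _; apply (sum_n_m_zero (G := R_AbelianMonoid)); lia.
- rewrite (RInt_split p c (c + INR m * h)) by exact Hp.
  rewrite IH.
  transitivity (RInt (fun s => 1 * sum_n_m (fun j => p (s + INR j * h)) 1 m
     + (1 * p (s + INR (S m) * h) + 0 * 0)) (c - h) c).
  + rewrite (RInt_comb _ _ (fun _ => 0)); [|apply continuous_sum_n_m; exact Hs|apply Hs|intro; cont].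
    pose proof (RInt_comp_lin (V := R_CompleteNormedModule) p 1 (INR (S m) * h) (c - h) c) as E.
    replace (1 * (c - h) + INR (S m) * h) with (c + INR m * h) in E by (rewrite S_INR; ring).
    replace (1 * c + INR (S m) * h) with (c + INR (S m) * h) in E by ring.
    assert (E' : RInt (fun y => p (y + INR (S m) * h)) (c - h) c
                 = RInt p (c + INR m * h) (c + INR (S m) * h)).
    { rewrite <- E by (apply ex_RInt_cont; exact Hp).
      apply RInt_eq; intro y; unfold scal; simpl; unfold mult; simpl.
      now rewrite !Rmult_1_l. }
    rewrite <- E'.
    match goal with |- ?x = ?y => change (@eq R x y) end; ring.
  + apply RInt_eq; intro s; rewrite sum_n_Sm by lia; unfold plus; simpl; ring.
Qed.

Lemma RInt_fourier_le (a b T K : R) (m : nat) (p : R -> R) (g : R -> C) :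
  0 < T -> 0 <= K -> (1 <= m)%nat -> a < b -> b - a = INR m * PI / T ->
  (forall t, continuous p t) -> ccont g ->
  (forall t, - T <= t <= T ->
     p t <= K * (ip a b g (cis t) ^ 2 + ip a b g (rot (cis t)) ^ 2)) ->
  RInt p (- T) T <= K * (2 * PI) * ip a b g g.
Proof.
intros HT HC Hm Hab HL Hp Hg H.
(* This [h] cuts [[-T, T]] into [m] cells and, since [b - a = m PI / T], also gives
   [h (b - a) = 2 PI], which is the orthogonality condition. *)
set (h := 2 * T / INR m).
assert (Hm0 : 0 < INR m) by (apply lt_0_INR; lia).
assert (Hh : 0 < h) by (apply Rdiv_lt_0_compat; lra).
assert (HmT : INR m * h = 2 * T) by (unfold h; field; lra).
assert (Hhp : h * (b - a) = 2 * PI) by (rewrite HL; unfold h; field; lra).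
replace T with (- T + INR m * h) at 2 by lra.
rewrite RInt_fold_lattice by exact Hp.
apply Rle_trans with (RInt (fun _ => K * ((b - a) * ip a b g g)) (- T - h) (- T)).
- apply RInt_le; [lra| | |].
  + apply ex_RInt_cont, continuous_sum_n_m.
    intros j u; apply (continuous_comp (fun s => s + INR j * h) p); cont.
  + apply ex_RInt_cont; intro; cont.
  + intros s Hs.
    pose proof (bessel a b (b - a) (fun j => cis (s + INR j * h)) m) as HB.
    apply Rle_trans with (K * sum_n_m (fun j => ip a b g (cis (s + INR j * h)) ^ 2
       + ip a b g (rot (cis (s + INR j * h))) ^ 2) 1 m).
    * apply (sum_n_m_rel (G := R_AbelianMonoid) (H := R_AbelianMonoid) (fun x y => x <= K * y)).
      -- change (@zero R_AbelianMonoid) with 0; lra.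
      -- unfold plus; simpl; intros; lra.
      (* For [s] between [- T - h] and [- T] and [1 <= j <= m], the frequency [s + j h] stays in
         [[-T, T]]. *)
      -- intros j Hj; apply H.
         assert (1 <= INR j) by (apply (le_INR 1); lia).
         assert (INR j <= INR m) by (apply le_INR; lia).
         nra.
    * apply Rmult_le_compat_l; [exact HC|].
      apply HB; try lra.
      -- intro; apply ccont_cis.
      -- intro; apply ip_cis_diag.
      -- intros; now apply ip_cis_orth.
      -- exact Hg.
- rewrite RInt_const; unfold scal; simpl; unfold mult; simpl.
  right; replace (- T - (- T - h)) with h by ring.
  rewrite <- Hhp; ring.
Qed.

(** * The kernel and a lower bound for its transform *)

Lemma Rinv_le_mult (x y : R) : 0 < x -> / x <= y -> 1 <= x * y.
Proof.
intros Hx H; apply Rmult_le_compat_l with (r := x) in H; [|lra].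
rewrite Rinv_r in H; lra.
Qed.

Lemma Rle_inv_mult (x y : R) : 0 < x -> y <= / x -> x * y <= 1.
Proof.
intros Hx H; apply Rmult_le_compat_l with (r := x) in H; [|lra].
rewrite Rinv_r in H; lra.
Qed.

(** This is [1 + x <= exp x] at [x = - v]; it supplies the upper bounds for [exp]. *)
Lemma exp_mult_le_1 (v : R) : exp v * (1 - v) <= 1.
Proof.
pose proof (exp_ineq1_le (- v)).
replace 1 with (exp v * exp (- v)) at 2 by (rewrite <- exp_plus, Rplus_opp_r; apply exp_0).
apply Rmult_le_compat_l; [left; apply exp_pos | lra].
Qed.

(* For [y = exp u] the weight [1 - |n - y| / (y / T)], cut off at 0, is
   [tent T (ln n - u)]. *)
Definition tent (T v : R) : R := Rmax 0 (1 - T * Rabs (exp v - 1)).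

Lemma continuous_tent (T : R) (v : R) : continuous (tent T) v.
Proof.
apply (continuous_ext (fun x => Rmax 0 (1 - T * Rabs (exp x - 1)))); [reflexivity|].
cont.
Qed.

Lemma tent_nonneg (T v : R) : 0 <= tent T v.
Proof. apply Rmax_l. Qed.

(** For [v >= 0], [exp v - 1 >= v >= 1 / T]. For [v < 0], [exp v <= 1 / (1 + |v|) <= (T - 1) / T];
    this side is what dictates [T - 1]. *)
Lemma tent_support (T v : R) : 1 < T -> / (T - 1) <= Rabs v -> tent T v = 0.
Proof.
intros HT Hv; unfold tent; rewrite Rmax_left; [reflexivity|].
assert (Hv1 : 1 <= (T - 1) * Rabs v) by (apply Rinv_le_mult; lra).
destruct (Rle_lt_dec 0 v) as [H0|H0].
- rewrite Rabs_right in Hv1 by lra.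
  pose proof (exp_ineq1_le v).
  rewrite Rabs_right by lra; nra.
- rewrite Rabs_left in Hv1 by lra.
  pose proof (exp_pos v) as H2; pose proof (exp_mult_le_1 v).
  assert (exp v < 1) by nra.
  rewrite Rabs_left by lra.
  assert (T <= (1 - v) * (T - 1)) by nra.
  assert (exp v * T <= T - 1) by nra.
  lra.
Qed.

(** For [0 <= v <= 1 / 4] one has [exp v <= 1 + 2 v], hence [T (exp v - 1) <= 2 T v <= 1 / 2]. *)
Lemma tent_ge_half (T v : R) : 1 <= T -> 0 <= v <= / (4 * T) -> / 2 <= tent T v.
Proof.
intros HT Hv; unfold tent.
assert (Tv : 4 * T * v <= 1) by (apply Rle_inv_mult; lra).
assert (v <= / 4) by nra.
pose proof (exp_ineq1_le v); pose proof (exp_pos v); pose proof (exp_mult_le_1 v).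
assert (exp v <= 1 + 2 * v) by nra.
rewrite Rabs_right by lra.
apply Rle_trans with (1 - T * (exp v - 1)); [nra | apply Rmax_r].
Qed.

(** Real and imaginary parts of [kappa t]. For [T >= 5] the support of the kernel lies in
    [[-1/4, 1/4]], because [1 / (T - 1) <= 1 / 4]. *)
Definition tent_cos (T t : R) : R := RInt (fun v => tent T v * cos (t * v)) (- / 4) (/ 4).
Definition tent_sin (T t : R) : R := RInt (fun v => tent T v * sin (t * v)) (- / 4) (/ 4).

(** On the support [|t v| <= 3 / 2 < PI / 2], so the integrand is nonnegative. On [[0, 1 / (4 T)]]
    both factors are at least [1 / 2], which contributes [1 / 4] times the length [1 / (4 T)]. *)
Lemma tent_cos_ge (T t : R) : 5 <= T -> - T <= t <= T -> / (16 * T) <= tent_cos T t.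
Proof.
intros HT Ht.
assert (Hd40 : 0 < / (4 * T)) by (apply Rinv_0_lt_compat; lra).
assert (Hd41 : / (4 * T) <= / 4) by (apply Rinv_le_contravar; lra).
pose proof PI2_3_2 as HPI.
set (f := fun v : R => tent T v * cos (t * v)).
assert (Hc : forall u, continuous f u).
{ intro u; apply continuous_Rmult; [apply continuous_tent | cont]. }
assert (Hpos : forall v, 0 <= f v).
{ intro v; unfold f; destruct (Rle_lt_dec (/ (T - 1)) (Rabs v)) as [H|H].
  - rewrite tent_support by lra; lra.
  - apply Rmult_le_pos; [apply tent_nonneg|].
    assert (Hvv : (T - 1) * Rabs v <= 1) by (apply Rle_inv_mult; lra).
    pose proof (Rabs_pos v).
    assert (Htv : Rabs (t * v) <= 3 / 2).
    { rewrite Rabs_mult; assert (Rabs t <= T) by (apply Rabs_le; lra).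
      apply Rle_trans with (T * Rabs v); [apply Rmult_le_compat_r; lra | nra]. }
    apply Rabs_le_between in Htv; apply cos_ge_0; lra. }
change (/ (16 * T) <= RInt f (- / 4) (/ 4)).
rewrite (RInt_split _ _ 0 _ Hc), (RInt_split _ 0 (/ (4 * T)) _ Hc).
assert (0 <= RInt f (- / 4) 0)
  by (apply RInt_nonneg; [lra | exact Hc | intros; apply Hpos]).
assert (0 <= RInt f (/ (4 * T)) (/ 4))
  by (apply RInt_nonneg; [lra | exact Hc | intros; apply Hpos]).
assert (/ (16 * T) <= RInt f 0 (/ (4 * T))); [|lra].
apply Rle_trans with (RInt (fun _ => / 4) 0 (/ (4 * T))).
- rewrite RInt_const; unfold scal; simpl; unfold mult; simpl; right; field; lra.
- apply RInt_le; [lra | apply ex_RInt_cont; intro; cont | apply ex_RInt_cont; exact Hc |].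
  intros v Hv.
  assert (Ht2 : / 2 <= tent T v) by (apply tent_ge_half; lra).
  assert (Hv4 : 4 * T * v <= 1) by (apply Rle_inv_mult; lra).
  unfold f; assert (Hc2 : / 2 <= cos (t * v)); [|nra].
  assert (Htv : Rabs (t * v) <= 1 / 4).
  { rewrite Rabs_mult, (Rabs_right v) by lra.
    assert (Rabs t <= T) by (apply Rabs_le; lra); nra. }
  (* By evenness the argument becomes [|t v| <= 1 / 4 < PI / 3], where the cosine exceeds
     [cos (PI / 3) = 1 / 2]. *)
  assert (E : cos (t * v) = cos (Rabs (t * v))).
  { unfold Rabs; destruct (Rcase_abs (t * v)); [now rewrite cos_neg | reflexivity]. }
  rewrite E; pose proof (Rabs_pos (t * v)).
  replace (/ 2) with (cos (PI / 3)) by (rewrite cos_PI3; lra).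
  apply cos_decr_1; lra.
Qed.

(** * The transform of the smoothed sum *)

(** Translating the kernel by [L] multiplies its transform by [e^(-itL)]; the two formulas are the
    parts of the product [kappa t * z]. The margin [1 / 4] keeps the support inside [[a, b]]. *)
Lemma ip_tent_cis (a b L T t : R) (c : C) :
  5 <= T -> a <= L - / 4 -> L + / 4 <= b ->
  let z := Cmult c (cos (t * L), - sin (t * L)) in
  let F := fun u => Cmult (RtoC (tent T (L - u))) c in
  ccont F /\
  ip a b F (cis t) = tent_cos T t * Re z - tent_sin T t * Im z /\
  ip a b F (rot (cis t)) = tent_cos T t * Im z + tent_sin T t * Re z.
Proof.
intros HT Ha Hb z F.
assert (Ht : forall u, continuous (tent T) u) by apply continuous_tent.
assert (HtL : forall u, continuous (fun u => tent T (L - u)) u).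
{ intro u; apply (continuous_comp (fun u => L - u) (tent T)); cont. }
assert (HT4 : / (T - 1) <= / 4) by (apply Rinv_le_contravar; lra).
assert (H0 : forall u, / 4 <= Rabs (L - u) -> tent T (L - u) = 0)
  by (intros; apply tent_support; lra).
assert (Hv : forall v, L - (L - v) = v) by (intro; ring).
assert (Hm : forall v, t * (L - v) = t * L - t * v) by (intro; ring).
destruct c as [c1 c2]; unfold F, z, ip, rot, cis; simpl.
assert (HF : ccont F).
{ split; intro u; unfold F; simpl; cont. }
split; [exact HF|].
unfold tent_cos, tent_sin; split.
- rewrite (RInt_reflect_support _ a b L (/ 4)); try lra.
  + transitivity (
      (c1 * cos (t * L) - c2 * - sin (t * L)) * RInt (fun v => tent T v * cos (t * v)) (- / 4) (/ 4)
      + ((- (c1 * - sin (t * L) + c2 * cos (t * L)))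
           * RInt (fun v => tent T v * sin (t * v)) (- / 4) (/ 4)
         + 0 * RInt (fun _ => 0) (- / 4) (/ 4))); [|ring].
    rewrite <- RInt_comb by (intro; cont).
    apply RInt_eq; intro v; rewrite Hv, Hm, cos_minus, sin_minus; ring.
  + intro u; cont.
  + intros u Hu; rewrite (H0 u Hu); ring.
- rewrite (RInt_reflect_support _ a b L (/ 4)); try lra.
  + transitivity (
      (c1 * - sin (t * L) + c2 * cos (t * L)) * RInt (fun v => tent T v * cos (t * v)) (- / 4) (/ 4)
      + ((c1 * cos (t * L) - c2 * - sin (t * L))
           * RInt (fun v => tent T v * sin (t * v)) (- / 4) (/ 4)
         + 0 * RInt (fun _ => 0) (- / 4) (/ 4))); [|ring].
    rewrite <- RInt_comb by (intro; cont).
    apply RInt_eq; intro v; rewrite Hv, Hm, cos_minus, sin_minus; ring.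
  + intro u; cont.
  + intros u Hu; rewrite (H0 u Hu); ring.
Qed.

Lemma ip_plus_l (a b : R) (f f' g : R -> C) :
  ccont f -> ccont f' -> ccont g ->
  ip a b (fun u => Cplus (f u) (f' u)) g = ip a b f g + ip a b f' g.
Proof.
intros [F1 F2] [F1' F2'] [G1 G2]; unfold ip.
transitivity (1 * RInt (fun u => Re (f u) * Re (g u) + Im (f u) * Im (g u)) a b
  + (1 * RInt (fun u => Re (f' u) * Re (g u) + Im (f' u) * Im (g u)) a b
     + 0 * RInt (fun _ => 0) a b)); [|lra].
rewrite <- RInt_comb by (intro; cont).
apply RInt_eq; intro u; unfold Re, Im; simpl; ring.
Qed.

Lemma ccont_plus (f g : R -> C) : ccont f -> ccont g -> ccont (fun u => Cplus (f u) (g u)).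
Proof.
intros [F1 F2] [G1 G2]; split; simpl; intro u; apply continuous_Rplus;
  first [apply F1 | apply F2 | apply G1 | apply G2].
Qed.

Lemma ccont_zero : ccont (fun _ => RtoC 0).
Proof. split; simpl; intro u; cont. Qed.

Lemma ip_zero_l (a b : R) (g : R -> C) : ip a b (fun _ => RtoC 0) g = 0.
Proof. apply RInt_zero; intros u _; simpl; ring. Qed.

(** With [L n = ln n] and [c n = w n * b n / sqrt n], [z] is the Dirichlet polynomial at [t].
    Continuity is carried through the induction because additivity of [ip] requires it. *)
Lemma ip_smoothed (a b T t : R) (N1 N2 : nat) (L : nat -> R) (c : nat -> C) :
  5 <= T ->
  (forall n, (N1 <= n <= N2)%nat -> a <= L n - / 4 /\ L n + / 4 <= b) ->
  let z := sum_n_m (fun n => Cmult (c n) (cos (t * L n), - sin (t * L n))) N1 N2 in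
  let F := fun u => sum_n_m (fun n => Cmult (RtoC (tent T (L n - u))) (c n)) N1 N2 in
  ccont F /\
  ip a b F (cis t) = tent_cos T t * Re z - tent_sin T t * Im z /\
  ip a b F (rot (cis t)) = tent_cos T t * Im z + tent_sin T t * Re z.
Proof.
intros HT HL.
assert (Hc := ccont_cis t); assert (Hr := ccont_rot _ Hc).
apply (sum_n_m_fct_rel (G := C_AbelianMonoid) (H := C_AbelianMonoid)
  (fun (F : R -> C) (z : C) => ccont F /\
     ip a b F (cis t) = tent_cos T t * Re z - tent_sin T t * Im z /\
     ip a b F (rot (cis t)) = tent_cos T t * Im z + tent_sin T t * Re z)
  (fun n u => Cmult (RtoC (tent T (L n - u))) (c n))).
- repeat split; try (intro u; simpl; cont); rewrite ip_zero_l; simpl; ring.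
- intros F F' y y' (F1 & F2 & F3) (F1' & F2' & F3').
  split; [exact (ccont_plus F F' F1 F1')|].
  split; [rewrite (ip_plus_l a b F F') by assumption; rewrite F2, F2'
         |rewrite (ip_plus_l a b F F') by assumption; rewrite F3, F3'];
    unfold plus, Re, Im; simpl; ring.
- intros n Hn; destruct (HL n Hn); now apply ip_tent_cis.
Qed.

(** * The short sum and the Dirichlet polynomial in logarithmic form *)

Lemma sum_n_m_support {G : AbelianMonoid} (f : nat -> G) (n m n' m' : nat) :
  (n <= n')%nat -> (n' <= S m')%nat -> (m' <= m)%nat ->
  (forall k, (n <= k <= m)%nat -> (k < n')%nat \/ (m' < k)%nat -> f k = zero) ->
  sum_n_m f n m = sum_n_m f n' m'.
Proof.
intros H1 H2 H3 H0.
assert (Z : forall i j, (n <= i)%nat -> (j <= m)%nat -> (j < n')%nat \/ (m' < i)%nat ->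
  sum_n_m f i j = zero).
{ intros i j Hi Hj Hij; rewrite (sum_n_m_ext_loc f (fun _ => zero)).
  - apply sum_n_m_const_zero.
  - intros k Hk; apply H0; lia. }
rewrite (sum_n_m_Chasles f n m' m) by lia.
rewrite (Z (S m') m), plus_zero_r by lia.
destruct n' as [|n'].
- now replace n with 0%nat by lia.
- rewrite (sum_n_m_Chasles f n n' m') by lia.
  now rewrite (Z n n'), plus_zero_l by lia.
Qed.

Lemma exp_half_ln (x : R) : 0 < x -> exp (/ 2 * ln x) = sqrt x.
Proof. intro Hx; change (Rpower x (/ 2) = sqrt x); now apply Rpower_sqrt. Qed.

Lemma Cdiv_npow_half (z : C) (n : nat) (t : R) :
  (1 <= n)%nat ->
  Cdiv z (npow n (1 / 2, t))
  = Cmult (Cdiv z (RtoC (sqrt (INR n)))) (cos (t * ln (INR n)), - sin (t * ln (INR n))).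
Proof.
intro Hn; assert (Hp : 0 < INR n) by (apply lt_0_INR; lia).
unfold Cdiv; rewrite <- Cmult_assoc; f_equal.
unfold npow, Cexp; simpl.
rewrite !Rmult_0_r, Rminus_0_r, Rplus_0_l.
replace (1 / 2) with (/ 2) by field; rewrite exp_half_ln by exact Hp.
pose proof (sqrt_lt_R0 _ Hp) as Hs; pose proof (sin2_cos2 (t * ln (INR n))) as E.
unfold Rsqr in E.
set (s := sqrt (INR n)) in *; set (x := cos _) in *; set (y := sin _) in *.
unfold Cinv, Cmult; simpl.
replace (s * x * (s * x * 1) + s * y * (s * y * 1)) with (s * s)
  by (transitivity (s * s * (y * y + x * x)); [rewrite E|]; ring).
f_equal; field; lra.
Qed.

(** With [y = exp u], [T |n / y - 1| = |n - y| / (y / T)], so the cutoff of [tent] at 0 reproduces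
    the window of the short sum, while [w] restricts [n] to [[N1, N2]]. *)
Lemma shortSum_exp (N1 N2 : nat) (w b : nat -> C) (T u : R) :
  (1 <= N1)%nat -> (N1 <= N2)%nat -> 0 < T ->
  (forall n : nat, (n < N1)%nat \/ (N2 < n)%nat -> w n = RtoC 0) ->
  shortSum w b T (exp u)
  = sum_n_m (fun n => Cmult (RtoC (tent T (ln (INR n) - u)))
                        (Cdiv (Cmult (w n) (b n)) (RtoC (sqrt (INR n))))) N1 N2.
Proof.
intros H1 H2 HT Hw; unfold shortSum, sumBetween.
pose proof (exp_pos u) as Hy; set (y := exp u) in *.
assert (HyT : 0 < y / T) by (apply Rdiv_lt_0_compat; lra).
set (c := fun n => Cdiv (Cmult (w n) (b n)) (RtoC (sqrt (INR n)))).
set (g := fun n => Cmult (RtoC (tent T (ln (INR n) - u))) (c n)).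
assert (Ht : forall n, (1 <= n)%nat ->
  tent T (ln (INR n) - u) = Rmax 0 (1 - Rabs (INR n - y) / (y / T))).
{ intros n Hn; assert (0 < INR n) by (apply lt_0_INR; lia).
  unfold tent; f_equal; unfold Rminus at 3; rewrite exp_plus, exp_Ropp, exp_ln by assumption.
  fold y; replace (INR n * / y - 1) with ((INR n - y) / y) by (field; lra).
  rewrite Rabs_div by lra; rewrite (Rabs_right y) by lra; field; lra. }
assert (Hout : forall n, (1 <= n)%nat -> ~ (y - y / T <= INR n <= y + y / T) -> g n = RtoC 0).
{ intros n Hn Hno; unfold g; rewrite Ht by exact Hn.
  rewrite Rmax_left; [apply Cmult_0_l|].
  assert (y / T <= Rabs (INR n - y)).
  { apply Rnot_lt_le; intro Hlt; apply Hno; apply Rabs_lt_between in Hlt; lra. }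
  assert (1 <= Rabs (INR n - y) / (y / T)); [|lra].
  apply (Rmult_le_reg_r (y / T)); [lra|].
  replace (Rabs (INR n - y) / (y / T) * (y / T)) with (Rabs (INR n - y)); [lra|field; lra]. }
set (X := Z.to_nat (up (y + y / T))).
assert (HX : forall n, (X < n)%nat -> y + y / T < INR n).
{ intros n Hn; destruct (archimed (y + y / T)) as [Hu _].
  apply Rlt_le_trans with (IZR (up (y + y / T))); [lra|].
  rewrite INR_IZR_INZ; apply IZR_le; lia. }
rewrite (sum_n_m_ext_loc (G := C_AbelianMonoid) _ g).
(* Both ranges are compared with [1 .. max X N2]: terms beyond [X] lie outside the window, and terms
   outside [[N1, N2]] vanish through [w]. *)
- transitivity (sum_n_m (G := C_AbelianMonoid) g 1 (max X N2)).
  + symmetry; apply sum_n_m_support; try lia.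
    intros k Hk Hk'; apply Hout; [lia|].
    assert (HXk : (X < k)%nat) by lia; apply HX in HXk; lra.
  + apply sum_n_m_support; try lia.
    intros k _ Hk; unfold g, c; rewrite (Hw k Hk).
    unfold Cdiv; now rewrite !Cmult_0_l, Cmult_0_r.
- intros n Hn.
  destruct (Rle_dec (y - y / T) (INR n)) as [Ha|Ha];
    [destruct (Rle_dec (INR n) (y + y / T)) as [Hb|Hb]|].
  + unfold g; rewrite Ht by lia; rewrite Rmax_right; [reflexivity|].
    assert (Rabs (INR n - y) <= y / T) by (apply Rabs_le; lra).
    assert (Rabs (INR n - y) / (y / T) <= 1); [|lra].
    apply (Rmult_le_reg_r (y / T)); [lra|].
    replace (Rabs (INR n - y) / (y / T) * (y / T)) with (Rabs (INR n - y)); [lra|field; lra].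
  + symmetry; apply Hout; [lia|lra].
  + symmetry; apply Hout; [lia|lra].
Qed.

Lemma dirichletPoly_eq (N1 N2 : nat) (w b : nat -> C) (t : R) :
  (1 <= N1)%nat ->
  dirichletPoly N1 N2 w b t
  = sum_n_m (fun n => Cmult (Cdiv (Cmult (w n) (b n)) (RtoC (sqrt (INR n))))
                        (cos (t * ln (INR n)), - sin (t * ln (INR n)))) N1 N2.
Proof.
intro H1; apply sum_n_m_ext_loc; intros n Hn; apply Cdiv_npow_half; lia.
Qed.

Lemma ccont_dirichletPoly (N1 N2 : nat) (w b : nat -> C) :
  (1 <= N1)%nat -> ccont (dirichletPoly N1 N2 w b).
Proof.
intro H1.
replace (dirichletPoly N1 N2 w b) with
  (fun t => sum_n_m (fun n => Cmult (Cdiv (Cmult (w n) (b n)) (RtoC (sqrt (INR n))))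
                        (cos (t * ln (INR n)), - sin (t * ln (INR n)))) N1 N2)
  by (apply functional_extensionality; intro; symmetry; now apply dirichletPoly_eq).
apply (sum_n_m_fct_rel (G := C_AbelianMonoid) (H := C_AbelianMonoid)
  (fun (F : R -> C) _ => ccont F)
  (fun n t => Cmult (Cdiv (Cmult (w n) (b n)) (RtoC (sqrt (INR n))))
                (cos (t * ln (INR n)), - sin (t * ln (INR n)))) (fun _ => RtoC 0)).
- exact ccont_zero.
- intros F F' _ _; apply ccont_plus.
- intros n _; set (z := Cdiv _ _); split; simpl; intro u; fold (Re z) (Im z); cont.
Qed.

(** [exp (1/4) <= 4/3], by [exp (1/4) * (3/4) <= 1]. The limits [N1 / 2] and [3 N2 / 2] thus leave a
    logarithmic margin of at least [1 / 4] around every [ln n]. *)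
Lemma ln_shift (x y : R) : 0 < x -> 4 / 3 * x <= y -> ln x + / 4 <= ln y.
Proof.
intros Hx Hxy.
rewrite <- (ln_exp (/ 4)), <- ln_mult by (try apply exp_pos; exact Hx).
apply ln_le; [apply Rmult_lt_0_compat; [exact Hx | apply exp_pos]|].
pose proof (exp_mult_le_1 (/ 4)).
nra.
Qed.

(** * The mean-square bound for the Dirichlet polynomial *)

Lemma RInt_dirichletPoly_le (N1 N2 : nat) (w b : nat -> C) (T : R) :
  (1 <= N1)%nat -> (N1 <= N2)%nat -> 5 <= T ->
  (forall n : nat, (n < N1)%nat \/ (N2 < n)%nat -> w n = RtoC 0) ->
  RInt (fun t : R => Cmod (dirichletPoly N1 N2 w b t) ^ 2) (- T) T
  <= 512 * PI * (T ^ 2 *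
       RInt (fun y : R => Cmod (shortSum w b T y) ^ 2 / y) (INR N1 / 2) (3 * INR N2 / 2)).
Proof.
intros H1 H2 HT Hw.
assert (P1 : 0 < INR N1) by (apply lt_0_INR; lia).
assert (P12 : INR N1 <= INR N2) by (apply le_INR; lia).
set (a := ln (INR N1 / 2)); set (d := ln (3 * INR N2 / 2)).
assert (Hn : forall n, (N1 <= n <= N2)%nat ->
  a <= ln (INR n) - / 4 /\ ln (INR n) + / 4 <= d).
{ intros n [Hn1 Hn2]; apply le_INR in Hn1, Hn2.
  assert (a + / 4 <= ln (INR n)) by (apply ln_shift; lra).
  assert (ln (INR n) + / 4 <= d) by (apply ln_shift; lra); lra. }
assert (Had : a < d) by (destruct (Hn N1 ltac:(lia)); lra).
(* The interval [[a, d]] is lengthened to [[a, e]], whose length is a positive integer multiple of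
   [PI / T], as the lattice argument requires. *)
destruct (INR_unbounded ((d - a) * T / PI)) as [m Hm].
pose proof PI_RGT_0 as HPI.
set (e := a + INR (S m) * PI / T).
assert (Hde : d <= e).
{ assert ((d - a) * T / PI <= INR (S m)) by (rewrite S_INR; lra).
  assert ((d - a) * T <= INR (S m) * PI).
  { replace ((d - a) * T) with ((d - a) * T / PI * PI) by (field; lra).
    apply Rmult_le_compat_r; lra. }
  assert (d - a <= INR (S m) * PI / T); [|unfold e; lra].
  apply (Rmult_le_reg_r T); [lra|].
  replace (INR (S m) * PI / T * T) with (INR (S m) * PI); [lra|field; lra]. }
set (c := fun n => Cdiv (Cmult (w n) (b n)) (RtoC (sqrt (INR n)))).
set (G := fun u => sum_n_m (G := C_AbelianMonoid)
  (fun n => Cmult (RtoC (tent T (ln (INR n) - u))) (c n)) N1 N2).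
assert (HG : ccont G).
{ apply (ip_smoothed a e T 0 N1 N2 (fun n => ln (INR n)) c HT).
  intros n Hn'; destruct (Hn n Hn'); lra. }
destruct HG as [G1 G2].
assert (Hend : ip a e G G
  = RInt (fun y : R => Cmod (shortSum w b T y) ^ 2 / y) (INR N1 / 2) (3 * INR N2 / 2)).
(* On [[a, d]] the substitution [u = ln y] gives [du = dy / y]. On [[d, e]] the function [G]
   vanishes, since [ln n - u] is below [- 1 / 4] there. *)
{ unfold ip; rewrite (RInt_split _ a d e) by (intro; cont).
  rewrite (RInt_zero _ d e), Rplus_0_r.
  - unfold a, d.
    rewrite <- (RInt_comp (V := R_CompleteNormedModule) _ ln (fun y => / y)).
    + apply RInt_ext; rewrite Rmin_left by lra; intros y [Hy _].
      assert (E : shortSum w b T y = G (ln y)).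
      { transitivity (shortSum w b T (exp (ln y))); [now rewrite exp_ln by lra|].
        apply (shortSum_exp N1 N2); assumption || lra. }
      rewrite E, Cmod2_alt; unfold scal; simpl; unfold mult; simpl; unfold Rdiv; ring.
    + intros y _; cont.
    + rewrite Rmin_left by lra; intros y [Hy _]; split.
      * auto_derive; [lra | field; lra].
      * apply continuous_Rinv_comp; [apply continuous_id | lra].
  - rewrite Rmin_left by lra; intros u [Hu _].
    replace (G u) with (RtoC 0); [simpl; ring|].
    unfold G; rewrite (sum_n_m_ext_loc (G := C_AbelianMonoid) _ (fun _ => RtoC 0)).
    + symmetry; apply (sum_n_m_const_zero (G := C_AbelianMonoid)).
    + intros n Hn'; destruct (Hn n Hn') as [_ Hd].
      assert (/ (T - 1) <= / 4) by (apply Rinv_le_contravar; lra).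
      rewrite tent_support; [apply Cmult_0_l | lra |].
      rewrite Rabs_left; lra. }
rewrite <- Hend.
(* [512 PI = 16^2 * 2 PI]: the factor [(16 T)^2] inverts the lower bound on [tent_cos], and [2 PI]
   comes from [RInt_fourier_le]. *)
replace (512 * PI * (T ^ 2 * ip a e G G))
  with (256 * T ^ 2 * (2 * PI) * ip a e G G) by ring.
destruct (ccont_dirichletPoly N1 N2 w b H1) as [D1 D2].
apply (RInt_fourier_le a e T (256 * T ^ 2) (S m)).
- lra.
- nra.
- lia.
- lra.
- unfold e; ring.
- intro t; apply (continuous_ext (fun t => Re (dirichletPoly N1 N2 w b t) * Re (dirichletPoly N1 N2 w b t)
    + Im (dirichletPoly N1 N2 w b t) * Im (dirichletPoly N1 N2 w b t))).
  + intro; rewrite Cmod2_alt; simpl; ring.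
  + cont.
- split; assumption.
- intros t Ht.
  destruct (ip_smoothed a e T t N1 N2 (fun n => ln (INR n)) c HT) as (_ & E1 & E2).
  { intros n Hn'; destruct (Hn n Hn'); lra. }
  fold G in E1, E2; rewrite E1, E2; unfold c.
  rewrite <- dirichletPoly_eq by exact H1.
  rewrite Cmod2_alt.
  set (x := Re _); set (y := Im _).
  pose proof (tent_cos_ge T t HT Ht) as Hk.
  set (k := tent_cos T t) in *; set (k' := tent_sin T t).
  assert (Hk1 : 1 <= 16 * T * k).
  { replace 1 with (16 * T * / (16 * T)) by (field; lra).
    apply Rmult_le_compat_l; lra. }
  (* The squared modulus of a product factors, and the real part [k] already makes the first factor
     at least 1. *)
  replace (256 * T ^ 2 * ((k * x - k' * y) ^ 2 + (k * y + k' * x) ^ 2))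
    with (((16 * T * k) ^ 2 + (16 * T * k') ^ 2) * (x ^ 2 + y ^ 2)) by ring.
  assert (0 <= x ^ 2 + y ^ 2) by nra.
  assert (1 <= (16 * T * k) ^ 2 + (16 * T * k') ^ 2).
  { pose proof (pow2_ge_0 (16 * T * k')); nra. }
  nra.
Qed.

Theorem mainTheorem3 :
  exists T0 : R, 1 < T0 /\
  forall (M : R) (B : R -> R), (forall e : R, 0 < e -> 0 < B e) ->
  forall eps : R, 0 < eps ->
  exists K : R, 0 < K /\
  forall (N1 N2 : nat) (w b : nat -> C) (T : R),
    (1 <= N1)%nat -> (N1 <= N2)%nat ->
    (forall n : nat, Cmod (w n) <= M) ->
    (forall n : nat, (n < N1)%nat \/ (N2 < n)%nat -> w n = RtoC 0) ->
    (forall e : R, 0 < e ->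
       forall n : nat, (1 <= n)%nat -> Cmod (b n) <= B e * Rpower (INR n) e) ->
    T0 <= T ->
    RInt (fun t : R => Cmod (dirichletPoly N1 N2 w b t) ^ 2) (- T) T
    <= K * (T ^ 2 *
              RInt (fun y : R => Cmod (shortSum w b T y) ^ 2 / y)
                   (INR N1 / 2) (3 * INR N2 / 2)
            + Rpower (INR N2) (1 + eps) / T ^ 2).
Proof.
pose proof PI_RGT_0 as HPI.
(* [T >= 5] ensures [1 / (T - 1) <= 1 / 4], so the kernel fits within the logarithmic margin. *)
exists 5; split; [lra|]; intros M B _ eps _.
exists (512 * PI); split; [lra|]; intros N1 N2 w b T H1 H2 _ Hw _ HT.
eapply Rle_trans; [now apply RInt_dirichletPoly_le|].
apply Rmult_le_compat_l; [lra|].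
assert (0 < Rpower (INR N2) (1 + eps)) by apply exp_pos.
assert (0 < Rpower (INR N2) (1 + eps) / T ^ 2) by (apply Rdiv_lt_0_compat; [lra | nra]).
lra.
Qed.
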